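(* Let $G$ be a connected simple graph on the vertex set $\{1,\ldots,n\}$. Then there exists a finite simple graph $H$ such that $P_{G}=I_{H}$ if and only if $G$ has at most one cycle.
   Context: $K$ is a field. A simple graph is a finite undirected graph without loops or multiple edges. Cycles are counted as subgraphs (a closed walk $(\{v_1,v_2\},\ldots,\{v_l,v_1\})$ with $l\ge3$ and $v_1,\ldots,v_l$ distinct, irrespective of starting point and direction). For a simple graph $G$ on $\{1,\ldots,n\}$ with $m$ edges, let $S=K[\{x_{ij},x_{ji} : \{i,j\}\in E(G)\}\cup\{x_{ii}\}_{1\le i\le n}]$, a polynomial ring in $2m+n$ variables. For $i<j$ put $f_{ij}=x_{ii}x_{jj}-x_{ij}x_{ji}$; $P_G\subset S$ is the ideal generated by all $f_{ij}$ with $\{i,j\}\in E(G)$. For a finite simple graph $H$ with vertices $v_1,\ldots,v_r$ and edges $z_1,\ldots,z_s$, the toric ideal $I_H$ is the kernel of the $K$-algebra homomorphism $K[y_1,\ldots,y_s]\to K[t_1,\ldots,t_r]$ sending $y_h\mapsto t_at_b$ where $z_h=\{v_a,v_b\}$. The equality $P_G=I_H$ means that $H$ has exactly $2m+n$ edges and that, for some bijection between the edges of $H$ and the variables of $S$ (identifying the edge variables $y_h$ with the variables of $S$), the ideals $P_G$ and $I_H$ of $S$ coincide. *)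

(* Defs.v *)
From HB Require Import structures.
From mathcomp Require Import all_boot all_order all_algebra.
From mathcomp Require Import mpoly.
Set Implicit Arguments.
Unset Strict Implicit.
Unset Printing Implicit Defensive.
Import GRing.Theory.
Local Open Scope ring_scope.

Record sgraph (n : nat) := SGraph {
  adj :> rel 'I_n;
  adj_sym : ssrbool.symmetric adj;
  adj_irr : irreflexive adj }.

Definition connected n (G : sgraph n) : Prop := forall i j, connect G i j.

Definition edges n (G : sgraph n) : {set {set 'I_n}} :=
  [set [set u.1; u.2] | u : 'I_n * 'I_n & G u.1 u.2].

(* A cycle is a subgraph without isolated vertices, so it is recorded by its
   edge set; this forgets the starting point and the direction of the closed
   walk [s]. *)
Definition is_cycle n (G : sgraph n) (C : {set {set 'I_n}}) : Prop :=
  exists s : seq 'I_n,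
    [/\ (2 < size s)%N, ucycle G s & C = [set [set x; next s x] | x in s]].

Definition at_most_one_cycle n (G : sgraph n) : Prop :=
  forall C D, is_cycle G C -> is_cycle G D -> C = D.

Definition ideal_gen (R : comNzRingType) (I : finType) (P : pred I)
    (F : I -> R) (p : R) : Prop :=
  exists c : I -> R, p = \sum_(i | P i) c i * F i.

(* The variables of S: the pair (i, j) stands for x_ij. *)
Definition Svar n (G : sgraph n) : finType :=
  {u : 'I_n * 'I_n | (u.1 == u.2) || G u.1 u.2}.

Definition Sring (K : fieldType) n (G : sgraph n) := {mpoly K[#|Svar G|]}.

(* The variable x_ij; the value 0 when x_ij is not a variable of S is a dummy
   that does not occur in the generators of P_G. *)
Definition xvar (K : fieldType) n (G : sgraph n) (i j : 'I_n) : Sring K G :=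
  if insub (i, j) is Some v then 'X_(enum_rank (v : Svar G)) else 0.

Definition fgen (K : fieldType) n (G : sgraph n) (i j : 'I_n) : Sring K G :=
  xvar K G i i * xvar K G j j - xvar K G i j * xvar K G j i.

Definition PG (K : fieldType) n (G : sgraph n) : Sring K G -> Prop :=
  ideal_gen (fun u : 'I_n * 'I_n => (u.1 < u.2)%N && G u.1 u.2)
    (fun u => fgen K G u.1 u.2).

(* The edge z_h = {v_a, v_b} is [enum_val h], and the product below is
   t_a * t_b. *)
Definition toric_map (K : fieldType) r (H : sgraph r)
    (p : {mpoly K[#|edges H|]}) : {mpoly K[r]} :=
  p \mPo [tuple \prod_(v in enum_val h) 'X_v | h < #|edges H|].

Definition toric_ideal (K : fieldType) r (H : sgraph r)
    (p : {mpoly K[#|edges H|]}) : Prop :=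
  toric_map p = 0.

Definition rename (K : fieldType) n (G : sgraph n) r (H : sgraph r)
    (sigma : 'I_#|edges H| -> Svar G) (p : {mpoly K[#|edges H|]}) : Sring K G :=
  p \mPo [tuple 'X_(enum_rank (sigma h)) | h < #|edges H|].

(* For [sigma] bijective, [rename sigma] is an isomorphism, so the last clause
   says that it carries I_H onto P_G. *)
Definition PG_eq_IH (K : fieldType) n (G : sgraph n) r (H : sgraph r) : Prop :=
  #|edges H| = (2 * #|edges G| + n)%N /\
  exists2 sigma : 'I_#|edges H| -> Svar G, bijective sigma &
    forall p : {mpoly K[#|edges H|]}, PG (rename sigma p) <-> toric_ideal p.

(* Main.v *)
Require Import Defs.
From mathcomp Require Import all_boot all_order all_algebra.
From mathcomp Require Import mpoly zify.

(** Write m for the number of edges of G.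

    Suppose P_G = I_H, and let e_a be the edge of H matched with the variable
    a of S. The binomial f_ij lies in I_H, so the edges e_ij and e_ji of H are
    contained in the union of e_ii and e_jj; hence the edges of H cover at most
    2n vertices. On the other hand the m + n variables x_ii, x_ij (i < j) are
    multiplicatively independent modulo P_G, since P_G is homogeneous for every
    weight w with w_ii + w_jj = w_ij + w_ji, and such a weight can be chosen
    freely on these m + n variables. If m + n exceeded 2n, the edges of H
    matched with them would satisfy an integer linear relation, which yields a
    binomial of I_H that is not homogeneous for some of these weights. So
    m <= n ([PG_toric_few_edges]). As G is connected, its cycle space over F_2
    has dimension m - n + 1 <= 1, and distinct cycles are distinct nonzero
    vectors of it ([cycle_space_dim]).

    Conversely, suppose that G has at most one cycle. Let H have two vertices
    (i, false), (i, true) for each vertex i of G, joined by the edge e_ii. For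
    an edge {i, j} of G the edges e_ij and e_ji complete e_ii and e_jj to a
    4-cycle, which can be done in two ways: twisted, where they join
    (i, false) to (j, true) and (j, false) to (i, true), or straight, where
    they keep the boolean. One edge on the cycle, if there is a cycle, is
    straight, all others are twisted ([ends]). Clearly P_G is contained in I_H.
    For the other inclusion, the rewriting of x_ij x_ji to x_ii x_jj brings
    each monomial to a standard one, divisible by no x_ij x_ji
    ([standard_form]); since I_H is spanned by binomials
    ([toric_ideal_binomials]), it suffices that distinct standard monomials
    have distinct images ([ends_separate]). If the images of two monomials with
    exponents u and v agree, then c = u - v gives d_ij = c_ij - c_ji, an
    antisymmetric function on the ordered edges which satisfies Kirchhoff's
    law at every vertex, up to a sign on the straight edge. Summing the law
    over all vertices kills d on the straight edge, so d is a flow on a forest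
    and vanishes. Hence c_ij = c_ji, and standardness forces c = 0. *)

Set Implicit Arguments.
Unset Strict Implicit.
Unset Printing Implicit Defensive.
Import Order.TTheory GRing.Theory Num.Theory.
Local Open Scope ring_scope.

(** * Cycles and the cycle space over F_2 *)

Lemma next_next_neq (T : eqType) (s : seq T) x :
  uniq s -> (2 < size s)%N -> x \in s -> next s (next s x) != x.
Proof.
move=> Us szs /rot_to[i s' def_s'].
rewrite -!(next_rot i Us) def_s'.
have: uniq (rot i s) by rewrite rot_uniq.
have: (2 < size (rot i s))%N by rewrite size_rot.
rewrite def_s'; case: s' {def_s'} => [|y [|z s']] //= _.
rewrite !inE !negb_or -!andbA => /and4P[xy xz _ _]; rewrite eqxx.
by rewrite [y == x]eq_sym (negPf xy) eqxx eq_sym.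
Qed.

(** In a cycle of length at least 3 the edge sent from x to its successor
    determines x: if it were also the edge from y, then each of x and y would
    follow the other. This lets sums over edges be turned into sums over
    vertices. *)
Lemma cycle_edge_inj (T : finType) (s : seq T) :
  uniq s -> (2 < size s)%N ->
  {in s &, injective (fun x => [set x; next s x])}.
Proof.
move=> Us szs x y xs ys /= eq_xy; apply/eqP/negPn/negP => neq_xy.
have: x \in [set y; next s y] by rewrite -eq_xy set21.
rewrite !inE (negPf neq_xy) => /eqP x_next.
have: y \in [set x; next s x] by rewrite eq_xy set21.
rewrite !inE eq_sym (negPf neq_xy) => /eqP y_next.
by have := next_next_neq Us szs xs; rewrite -y_next -x_next eqxx.
Qed.

(** The two edges of the cycle at v are the one leaving v and the one
    arriving from its predecessor. *)
Lemma cycle_even_degree (T : finType) (s : seq T) v :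
  uniq s -> (2 < size s)%N ->
  (\sum_(e in [set [set x; next s x] | x in s]) (v \in e) = (v \in s).*2)%N.
Proof.
move=> Us szs; rewrite big_imset; last exact: cycle_edge_inj.
have nx x : x \in s -> next s x != x.
  move=> xs; apply/eqP => nxx.
  by have := next_next_neq Us szs xs; rewrite !nxx eqxx.
transitivity (\sum_(x in s) ((x == v) + (x == prev s v)))%N.
  apply: eq_bigr => x xs; rewrite !inE.
  have -> : (v == next s x) = (x == prev s v).
    by apply/eqP/eqP => ->; rewrite ?prev_next ?next_prev.
  rewrite [v == x]eq_sym; case: eqP => [<-|] //=.
  have -> // : (x == prev s x) = false.
  by apply/eqP => px; have := nx _ xs; rewrite {1}px next_prev ?eqxx.
have card1 w : (\sum_(x in s) (x == w) = (w \in s))%N.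
  case: (boolP (w \in s)) => ws.
    rewrite (bigD1 w) //= eqxx big1 // => x /andP[_ /negPf ->] //.
  by rewrite big1 // => x xs; case: eqP => // xw; rewrite -xw xs in ws.
by rewrite big_split /= !card1 mem_prev addnn.
Qed.

Lemma edge_imset n (G : sgraph n) (C : {set {set 'I_n}}) : is_cycle G C ->
  [/\ C \subset edges G, C != set0 &
      forall v, ~~ odd (\sum_(e in C) (v \in e))].
Proof.
case=> s [szs /andP[cycs Us] ->]; split.
- apply/subsetP => _ /imsetP[x xs ->]; apply/imsetP; exists (x, next s x) => //.
  by rewrite inE /= next_cycle.
- apply/set0Pn; case: s szs {cycs Us} => // x s _.
  by exists [set x; next (x :: s) x]; apply/imsetP; exists x; rewrite ?mem_head.
- by move=> v; rewrite cycle_even_degree // odd_double.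
Qed.

(** The indicator vectors over F_2 of cycles lie in the kernel of the
    incidence matrix. Its rank is at least n - 1, because a function on the
    vertices that agrees at the ends of each edge is constant on a connected
    graph; so the kernel has dimension at most m - n + 1 <= 1. Over F_2 a line
    has a single nonzero vector. *)
Lemma cycle_space_dim n (G : sgraph n) : connected G ->
  (#|edges G| <= n)%N -> at_most_one_cycle G.
Proof.
move=> connG le_mn C D cycC cycD.
have [n0|n_gt0] := posnP n.
  have [_ /set0Pn[e eC] _] := edge_imset cycC.
  have [/subsetP sC _ _] := edge_imset cycC.
  have /imsetP[[u ? ] _ _] := sC _ eC.
  by have := ltn_ord u; rewrite {2}n0.
pose M := \matrix_(h < #|edges G|, v < n) ((v \in enum_val h)%:R : 'F_2).
pose chi (X : {set {set 'I_n}}) :=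
  \row_(h < #|edges G|) ((enum_val h \in X)%:R : 'F_2).
have cyc_ker X : is_cycle G X -> (chi X <= kermx M)%MS /\ chi X != 0.
  case/edge_imset=> /subsetP sX /set0Pn[e eX] evX; split.
    apply/sub_kermxP/rowP => v; rewrite !mxE.
    have := evX v; rewrite -dvdn2; set d := bigop _ _ _ => d2.
    transitivity (d%:R : 'F_2); last first.
      by apply/eqP; rewrite -(dvdn_pcharf (pchar_Fp _)).
    rewrite natr_sum [RHS](eq_bigl (fun e => (e \in edges G) && (e \in X)));
      last first.
      by move=> f; case: (boolP (f \in X)) => [/sX ->|]; rewrite ?andbF.
    rewrite big_mkcondr /= [RHS]big_enum_val /=; apply: eq_bigr => h _.
    by rewrite !mxE; case: ifP => _; rewrite ?mul0r ?mul1r.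
  have eG := sX _ eX.
  apply/eqP => /rowP/(_ (enum_rank_in eG e)); rewrite !mxE enum_rankK_in // eX.
  by move/eqP; rewrite oner_eq0.
have chi_inj (X Y : {set {set 'I_n}}) :
  X \subset edges G -> Y \subset edges G -> chi X = chi Y -> X = Y.
  move=> /subsetP sX /subsetP sY eqXY; apply/setP => e.
  case: (boolP (e \in edges G)) => eG; last first.
    by apply/idP/idP => [/sX|/sY]; rewrite (negPf eG).
  move/rowP/(_ (enum_rank_in eG e)): eqXY; rewrite !mxE enum_rankK_in //.
  by case: (e \in X); case: (e \in Y) => // /eqP.
have rkM : (n.-1 <= \rank M)%N.
  have : (kermx M^T <= (const_mx 1 : 'rV_n))%MS.
    apply/rV_subP => c /sub_kermxP cM.
    have eqc (i j : 'I_n) : G i j -> c 0 i = c 0 j.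
      move=> Gij; have eG : [set i; j] \in edges G.
        by apply/imsetP; exists (i, j); rewrite ?inE.
      move/rowP/(_ (enum_rank_in eG [set i; j])): cM; rewrite !mxE.
      rewrite (eq_bigr (fun k => if k \in [set i; j] then c 0 k else 0));
        last first.
        by move=> k _; rewrite !mxE enum_rankK_in //; case: ifP;
          rewrite ?mulr1 ?mulr0.
      rewrite -big_mkcond big_setU1 ?big_set1 /=; last first.
        by rewrite inE; apply: contraTneq Gij => ->; rewrite adj_irr.
      by move/eqP; rewrite addr_eq0 oppr_pchar2 ?pchar_Fp // => /eqP.
    have cc (i : 'I_n) : c 0 i = c 0 (Ordinal n_gt0).
      have /connectP[p] := connG i (Ordinal n_gt0).
      elim: p i => [|k p IH] i /= => [_ -> //|/andP[Gik pthk] lastk].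
      by rewrite (eqc _ _ Gik) (IH k).
    apply/sub_rVP; exists (c 0 (Ordinal n_gt0)); apply/rowP => i.
    by rewrite !mxE mulr1 cc.
  move/mxrankS; rewrite mxrank_ker mxrank_tr => /leq_trans/(_ (rank_leq_row _)).
  by rewrite leq_subLR addnC -subn1 leq_subLR addnC.
have rkker : (\rank (kermx M) <= 1)%N.
  rewrite mxrank_ker leq_subLR addn1 (leq_trans le_mn) //.
  exact: (leq_trans (leqSpred n) (rkM : (n.-1 < (\rank M).+1)%N)).
have [sC nzC] := cyc_ker C cycC; have [sD nzD] := cyc_ker D cycD.
have [subC _ _] := edge_imset cycC; have [subD _ _] := edge_imset cycD.
apply: chi_inj => //.
have rk1 (r : 'rV['F_2]_#|edges G|) : r != 0 -> \rank r = 1%N.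
  by move=> nzr; rewrite rank_rV nzr.
have /eqmxP/eqmx_sym eqC : (chi C == kermx M)%MS.
  by rewrite -(geq_leqif (mxrank_leqif_eq sC)) rk1.
move: sD; rewrite eqC => /sub_rVP[a Da]; rewrite Da.
move: nzD; rewrite Da; case: a {Da} => [[|[|?]] ?] //.
  by rewrite (_ : Ordinal _ = 0) ?scale0r ?eqxx //; apply: val_inj.
by move=> _; rewrite (_ : Ordinal _ = 1) ?scale1r //; apply: val_inj.
Qed.

(** * Cycles from minimum degree two, and transversals of cycles *)

(** A simple path that cannot be extended closes up: its first vertex has a
    neighbour other than the second vertex, which must lie on the path. The
    induction is on the number of vertices that are still available. *)
Lemma leafless_has_cycle (T : finType) (e : rel T) x0 y0 :
  ssrbool.symmetric e -> irreflexive e -> e x0 y0 ->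
  (forall x y, e x y -> exists2 z, e x z & z != y) ->
  exists2 s, (2 < size s)%N & ucycle e s.
Proof.
move=> sym_e irr_e exy0 leafless.
suff longest k x y q : (#|T| - size q <= k)%N -> path e x (y :: q) ->
    uniq [:: x, y & q] -> exists2 s, (2 < size s)%N & ucycle e s.
  apply: (longest _ x0 y0 [::] (leqnn _)); rewrite /= ?exy0 // inE andbT.
  by apply: contraTneq exy0 => ->; rewrite irr_e.
elim: k x y q => [|k IH] x y q le_k pth Uq.
  have := max_card (mem [:: x, y & q]); rewrite (card_uniqP Uq) /=.
  by move: le_k; rewrite leqn0 subn_eq0 => le1 /leq_trans/(_ le1);
    rewrite ltnNge leqnSn.
have [z exz zy] : exists2 z, e x z & z != y by apply: leafless; case/andP: pth.
have [zq|zq] := boolP (z \in q).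
  case/splitPr: q / zq pth Uq le_k => q1 q2 pth Uq _.
  exists (x :: y :: rcons q1 z); first by rewrite /= size_rcons.
  move: pth Uq; rewrite -!cat_rcons -!cat_cons cat_uniq cat_path /=.
  move=> /andP[/andP[exy pq] _] /andP[U _].
  rewrite /ucycle; apply/andP; split; last exact: U.
  by rewrite /= exy rcons_path pq /= last_rcons sym_e.
apply: (IH z x (y :: q)).
- by rewrite /= subnS -subn1 leq_subLR add1n.
- by rewrite /= [e z x]sym_e exz.
- rewrite cons_uniq Uq andbT !inE (negPf zy) (negPf zq) !orbF.
  by apply: contraTneq exz => ->; rewrite irr_e.
Qed.

(** T is one edge of the cycle, or empty when G is a forest. *)
Lemma cycle_transversal n (G : sgraph n) : at_most_one_cycle G ->
  exists T : {set {set 'I_n}}, [/\ (#|T| <= 1)%N, T \subset edges G &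
    forall C, is_cycle G C -> exists2 e, e \in C & e \in T].
Proof.
move=> one_cycle.
have [/existsP[k /existsP[t /andP[szt cyc_t]]]|no_cycle] := boolP
    [exists k : 'I_n.+1, exists t : k.-tuple 'I_n,
       (2 < k)%N && ucycleb G t].
  have cycC : is_cycle G [set [set x; next t x] | x in t].
    by exists t; rewrite size_tuple.
  have [/subsetP subC /set0Pn[e eC] _] := edge_imset cycC.
  exists [set e]; split=> [||C /(one_cycle _ _ cycC) <-].
  - by rewrite cards1.
  - by rewrite sub1set subC.
  - by exists e; rewrite ?inE.
exists set0; split=> [||C [s [szs cyc_s _]]]; rewrite ?cards0 ?sub0set //.
case/negP: no_cycle.
have lt_sn : (size s < n.+1)%N.
  case/andP: cyc_s => _ Us; rewrite ltnS -(card_uniqP Us).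
  by rewrite (leq_trans (max_card _)) ?card_ord.
apply/existsP; exists (Ordinal lt_sn); apply/existsP; exists (in_tuple s).
exact/andP.
Qed.

(** * The variables of S *)

Lemma swap_subproof n (G : sgraph n) (a : Svar G) :
  ((val a).2 == (val a).1) || G (val a).2 (val a).1.
Proof. by rewrite eq_sym adj_sym; exact: (valP a). Qed.

Lemma diag_subproof n (G : sgraph n) (i : 'I_n) :
  ((i, i).1 == (i, i).2) || G (i, i).1 (i, i).2.
Proof. by rewrite eqxx. Qed.

(** [swap a] is x_ji when [a] is x_ij; a diagonal variable is its own swap.
    With [src a] = x_ii and [dst a] = x_jj, each f_ij becomes an expression in
    a single element of [Svar G], which is 0 at a diagonal element. *)
Definition swap n (G : sgraph n) (a : Svar G) : Svar G :=
  Sub ((val a).2, (val a).1) (swap_subproof a).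
Definition diag n (G : sgraph n) (i : 'I_n) : Svar G :=
  Sub (i, i) (diag_subproof G i).
Definition src n (G : sgraph n) (a : Svar G) : Svar G := diag G (val a).1.
Definition dst n (G : sgraph n) (a : Svar G) : Svar G := diag G (val a).2.

Lemma swapK n (G : sgraph n) : involutive (@swap n G).
Proof. by move=> a; apply: val_inj => /=; case: (val a). Qed.

Lemma src_swap n (G : sgraph n) (a : Svar G) : src (swap a) = dst a.
Proof. by []. Qed.

Lemma dst_swap n (G : sgraph n) (a : Svar G) : dst (swap a) = src a.
Proof. by []. Qed.

Lemma Svar_diag n (G : sgraph n) (a : Svar G) :
  (val a).1 = (val a).2 -> a = diag G (val a).1.
Proof. by move=> e; apply: val_inj => /=; rewrite {2}e -surjective_pairing. Qed.

Lemma Svar_adj n (G : sgraph n) (a : Svar G) :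
  (val a).1 != (val a).2 -> G (val a).1 (val a).2.
Proof. by have := valP a; case: eqP. Qed.

Lemma card_Svar_upper n (G : sgraph n) :
  #|[set a : Svar G | (val a).1 < (val a).2]%N| = #|edges G|.
Proof.
pose f (a : Svar G) := [set (val a).1; (val a).2].
rewrite -(card_in_imset (f := f)); last first.
  move=> a b; rewrite !inE => la lb eqf.
  have: (val a).1 \in f b by rewrite -eqf set21.
  have: (val a).2 \in f b by rewrite -eqf set22.
  rewrite !inE => /orP[]/eqP e2 /orP[]/eqP e1; move: la lb;
    rewrite e1 e2 ?ltnn //.
    by move/ltn_trans/[apply]; rewrite ltnn.
  by move=> _ _; apply: val_inj; apply/eqP;
    rewrite -pair_eqE /pair_eq e1 e2 !eqxx.
apply: eq_card => e; apply/imsetP/imsetP.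
  case=> a; rewrite inE => la ->; exists (val a) => //.
  by rewrite inE Svar_adj // -val_eqE ltn_eqF.
case=> -[i j]; rewrite inE /= => Gij ->.
case: (ltngtP i j) => [lij|lji|/val_inj eij].
- have ok : ((i, j).1 == (i, j).2) || G (i, j).1 (i, j).2 by rewrite Gij orbT.
  by exists (Sub (i, j) ok); rewrite ?inE.
- have ok : ((j, i).1 == (j, i).2) || G (j, i).1 (j, i).2.
    by rewrite /= adj_sym Gij orbT.
  by exists (Sub (j, i) ok); rewrite ?inE //= /f /= setUC.
- by rewrite eij adj_irr in Gij.
Qed.

Lemma card_Svar_diag n (G : sgraph n) :
  #|[set a : Svar G | (val a).1 == (val a).2]| = n.
Proof.
rewrite -[RHS]card_ord -cardsT -(card_imset _ (f := diag G)); last first.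
  by move=> i j /(congr1 val) [].
apply: eq_card => a; rewrite inE;
  apply/eqP/imsetP => [/Svar_diag ->|[i _ ->] //].
by exists (val a).1; rewrite ?inE.
Qed.

(** The variables x_ij with i <= j are those on which a weight can be
    prescribed arbitrarily. *)
Lemma card_Svar_base n (G : sgraph n) :
  #|[set a : Svar G | (val a).1 <= (val a).2]%N| = (#|edges G| + n)%N.
Proof.
rewrite -card_Svar_upper -[X in (_ + X)%N](card_Svar_diag G) addnC -cardsUI.
rewrite [X in (_ + X)%N](_ : _ = 0%N) ?addn0.
  by apply: eq_card => a; rewrite !inE leq_eqVlt.
apply/eqP; rewrite cards_eq0; apply/eqP/setP => a; rewrite !inE.
by case: eqP => //= ->; rewrite ltnn.
Qed.

Lemma card_Svar n (G : sgraph n) : #|Svar G| = (2 * #|edges G| + n)%N.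
Proof.
rewrite mul2n -addnn -addnA -card_Svar_base -cardsT.
rewrite -(cardsID [set a : Svar G | (val a).1 <= (val a).2]%N) setTI addnC.
congr addn; rewrite -card_Svar_upper -(card_imset _ (can_inj (@swapK n G))).
apply: eq_card => a; apply/imsetP/idP.
  by case=> b; rewrite !inE andbT -ltnNge => lb ->.
by rewrite !inE => la; exists (swap a); rewrite ?inE ?swapK //= andbT -ltnNge.
Qed.

(** * The ideal P_G *)

Definition var (K : fieldType) n (G : sgraph n) (a : Svar G) : Sring K G :=
  'X_(enum_rank a).

Definition mon (K : fieldType) n (G : sgraph n) (u : Svar G -> nat) :
  Sring K G :=
  \prod_a var K a ^+ u a.

Lemma xvarE (K : fieldType) n (G : sgraph n) (a : Svar G) :
  xvar K G (val a).1 (val a).2 = var K a.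
Proof. by rewrite /xvar -surjective_pairing valK. Qed.

Lemma fgenE (K : fieldType) n (G : sgraph n) (a : Svar G) :
  fgen K G (val a).1 (val a).2 =
  var K (src a) * var K (dst a) - var K a * var K (swap a).
Proof. by rewrite -!xvarE. Qed.

Lemma PG_lin (K : fieldType) n (G : sgraph n) (c p q : Sring K G) :
  PG p -> PG q -> PG (c * p + q).
Proof.
move=> [f ->] [g ->]; exists (fun u => c * f u + g u).
rewrite mulr_sumr -big_split; apply: eq_bigr => u _ /=.
by rewrite mulrDl mulrA.
Qed.

Lemma PG0 (K : fieldType) n (G : sgraph n) : PG (0 : Sring K G).
Proof. by exists (fun=> 0); rewrite big1 // => u _; rewrite mul0r. Qed.

Lemma PG_mul (K : fieldType) n (G : sgraph n) (c p : Sring K G) :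
  PG p -> PG (c * p).
Proof. by move=> Pp; rewrite -[_ * _]addr0; apply: PG_lin => //;
  apply: PG0. Qed.

Lemma PG_trans (K : fieldType) n (G : sgraph n) (p q s : Sring K G) :
  PG (p - q) -> PG (q - s) -> PG (p - s).
Proof.
by move=> Ppq Pqs; rewrite -[p - s](subrKA q) -[p - q]mul1r; apply: PG_lin.
Qed.

Lemma PG_sym (K : fieldType) n (G : sgraph n) (p q : Sring K G) :
  PG (p - q) -> PG (q - p).
Proof. by move=> Ppq; rewrite -opprB -mulN1r; apply: PG_mul. Qed.

Lemma PG_gen (K : fieldType) n (G : sgraph n) (a : Svar G) :
  PG (var K (src a) * var K (dst a) - var K a * var K (swap a)).
Proof.
have upper (b : Svar G) : ((val b).1 < (val b).2)%N ->
    PG (var K (src b) * var K (dst b) - var K b * var K (swap b)).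
  move=> lb; exists (fun u => (u == val b)%:R).
  rewrite (bigD1 (val b)) /=; last first.
    by rewrite lb Svar_adj // -val_eqE ltn_eqF.
  rewrite eqxx mul1r big1 ?addr0 => [|u /andP[_ /negPf ->]];
    last by rewrite mul0r.
  by rewrite fgenE.
case: (ltngtP (val a).1 (val a).2) => [|la|/val_inj eqa]; first exact: upper.
  have := upper (swap a) la.
  by rewrite src_swap dst_swap swapK mulrC [var K (swap a) * _]mulrC.
rewrite (Svar_diag eqa).
by rewrite (_ : swap _ = diag G (val a).1) ?subrr; [apply: PG0|apply: val_inj].
Qed.

Lemma PG_rmorph (K : fieldType) n (G : sgraph n) (R : comNzRingType)
    (phi : {rmorphism Sring K G -> R}) :
  (forall a : Svar G,
     phi (var K (src a) * var K (dst a)) = phi (var K a * var K (swap a))) ->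
  forall p, PG p -> phi p = 0.
Proof.
move=> phi0 _ [c ->]; rewrite rmorph_sum big1 // => -[i j] /andP[_ /= Gij].
have ok : ((i, j).1 == (i, j).2) || G (i, j).1 (i, j).2 by rewrite Gij orbT.
rewrite rmorphM (fgenE K (Sub (i, j) ok : Svar G)) rmorphB.
by rewrite phi0 subrr mulr0.
Qed.

(** Substituting 'X^(w a) for the variable a maps P_G to 0, hence the
    binomial to 'X^N - 'X^M, with N and M the weights of u and v. *)
Lemma PG_weight (K : fieldType) n (G : sgraph n) (w u v : Svar G -> nat) :
  (forall a, w (src a) + w (dst a) = w a + w (swap a))%N ->
  PG (mon K u - mon K v) -> (\sum_a w a * u a = \sum_a w a * v a)%N.
Proof.
move=> wE Puv.
pose h (i : 'I_#|Svar G|) : {poly K} := 'X^(w (enum_val i)).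
have hvar a : (mmap polyC h) (var K a) = 'X^(w a).
  by rewrite /var mmapX mmap1U /h enum_rankK.
have hmon t : (mmap polyC h) (mon K t) = 'X^(\sum_a w a * t a)%N.
  rewrite rmorph_prod /= -prodrXr; apply: eq_bigr => a _.
  by rewrite rmorphXn /= hvar -exprM.
have := PG_rmorph (phi := mmap polyC h) _ Puv.
rewrite rmorphB /= !hmon => e.
have /e/eqP : forall a : Svar G, mmap polyC h (var K (src a) * var K (dst a)) =
    mmap polyC h (var K a * var K (swap a)).
  by move=> a; rewrite !rmorphM /= !hvar -!exprD wE.
by rewrite subr_eq0 => /eqP/(congr1 (size : {poly K} -> nat));
  rewrite !size_polyXn => -[].
Qed.

(** * Standard monomials *)

(** These are the monomials outside the initial ideal of P_G for an order in
    which x_ij x_ji is the leading monomial of f_ij. *)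
Definition standard n (G : sgraph n) (u : Svar G -> nat) :=
  forall a, (val a).1 != (val a).2 -> (u a == 0%N) || (u (swap a) == 0%N).

Lemma mon_incr (K : fieldType) n (G : sgraph n) (u : Svar G -> nat) b :
  mon K (fun a => u a + (a == b))%N = mon K u * var K b.
Proof.
rewrite /mon; under eq_bigr do rewrite exprD.
rewrite big_split /=; congr (_ * _).
by rewrite (bigD1 b) //= eqxx big1 ?mulr1 // => a /negPf ->.
Qed.

Lemma eq_mon (K : fieldType) n (G : sgraph n) (u v : Svar G -> nat) :
  u =1 v -> mon K u = mon K v.
Proof. by move=> uv; apply: eq_bigr => a _; rewrite uv. Qed.

(** Replacing x_ij x_ji by x_ii x_jj does not change the class modulo P_G
    and lowers the degree in the variables off the diagonal by two. *)
Lemma standard_form (K : fieldType) n (G : sgraph n) (u : Svar G -> nat) :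
  exists2 v : Svar G -> nat, standard v & PG (mon K u - mon K v).
Proof.
pose off (a : Svar G) := (val a).1 != (val a).2.
have [N] := ubnP (\sum_(a | off a) u a)%N.
elim: N u => // N IH u leN.
have [/existsP[a /and3P[off_a ua usa]]|] := boolP
    [exists a, [&& off a, 0 < u a & 0 < u (swap a)]%N]; last first.
  move=> /existsPn std; exists u; last by rewrite subrr; apply: PG0.
  by move=> a off_a; have := std a;
    rewrite (off_a : off a) /= negb_and -!eqn0Ngt.
have neq_a : swap a != a.
  by apply: contraNneq off_a => /(congr1 (fun b : Svar G => (val b).1)) /= ->.
pose t b := (u b - (b == a) - (b == swap a))%N.
pose t' b := (t b + (b == src a) + (b == dst a))%N.
have uE : u =1 (fun b => t b + (b == a) + (b == swap a))%N.
  move=> b; rewrite /t; case: (eqVneq b a) => [->|_].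
    by rewrite eq_sym (negPf neq_a) /= subn0 addn0 subnK.
  by case: (eqVneq b (swap a)) => [->|_]; rewrite /= ?subn0 ?addn0 ?subnK.
have Put : PG (mon K u - mon K t').
  rewrite (eq_mon K uE) /t' !mon_incr -!mulrA -mulrBr.
  by apply/PG_mul/PG_sym/PG_gen.
have sum_t : (\sum_(b | off b) t b < \sum_(b | off b) u b)%N.
  rewrite [X in (_ < X)%N](eq_bigr (fun b =>
    t b + (b == a) + (b == swap a))%N) //.
  rewrite !big_split /= -addnA -[X in (X < _)%N]addn0 ltn_add2l.
  by rewrite (bigD1 a) //= eqxx.
have sum_t' : (\sum_(b | off b) t' b = \sum_(b | off b) t b)%N.
  apply: eq_bigr => b off_b; rewrite /t'.
  have nd i : (b == diag G i) = false.
    by apply: contraNF off_b => /eqP ->; rewrite /= eqxx.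
  by rewrite !nd !addn0.
have [|v stdv Ptv] := IH t'; first by rewrite sum_t' (leq_trans sum_t).
by exists v => //; apply: PG_trans Put Ptv.
Qed.

(** * Toric ideals and degree vectors *)

(** The exponent of the image under the toric map of the monomial with
    exponent m, one edge of H contributing 1 at both of its ends. *)
Definition tdeg r (H : sgraph r) (m : 'X_{1..#|edges H|}) : 'X_{1..r} :=
  [multinom (\sum_(h < #|edges H|) (x \in enum_val h) * m h)%N | x < r].

Lemma toric_mapX (K : fieldType) r (H : sgraph r) (m : 'X_{1..#|edges H|}) :
  toric_map 'X_[m] = 'X_[tdeg m] :> {mpoly K[r]}.
Proof.
rewrite /toric_map comp_mpolyX [RHS]mpolyXE_id.
under eq_bigr => h _ do rewrite tnth_mktuple big_mkcond -prodrXl.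
rewrite exchange_big /=; apply: eq_bigr => x _.
rewrite mnmE -prodrXr; apply: eq_bigr => h _.
by case: ifP => _; rewrite ?mul1n ?mul0n ?expr1n.
Qed.

(** Each monomial of p is compared with the first monomial of p that has the
    same image. What remains after subtracting these binomials has, as its
    coefficient at a chosen monomial, a coefficient of the image of p, which
    is zero, and no other monomial occurs in it. *)
Lemma toric_ideal_binomials (K : fieldType) r (H : sgraph r)
    (P : {mpoly K[#|edges H|]} -> Prop) :
  P 0 -> (forall c p q, P p -> P q -> P (c *: p + q)) ->
  (forall m m', tdeg m = tdeg m' -> P ('X_[m] - 'X_[m'])) ->
  forall p, toric_ideal p -> P p.
Proof.
move=> P0 Plin Pbin p tp0.
pose rep k := nth 0%MM (msupp p) (find (fun m => tdeg m == k) (msupp p)).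
have tdeg_rep m : m \in msupp p -> tdeg (rep (tdeg m)) = tdeg m.
  by move=> mp; apply/eqP/(nth_find 0%MM (a := fun m' => tdeg m' == tdeg m));
    apply/hasP; exists m.
have Esum :
    \sum_(m <- msupp p) p@_m *: 'X_[rep (tdeg m)] = 0 :> {mpoly K[#|edges H|]}.
  apply/mpolyP => l; rewrite raddf_sum mcoeff0 /=.
  have [repl|repl] := eqVneq (rep (tdeg l)) l.
    have : (toric_map p)@_(tdeg l) = 0 by rewrite tp0 mcoeff0.
    rewrite {1}[p]mpolyE /toric_map (linear_sum (comp_mpoly _)) raddf_sum /=.
    move=> e; rewrite -[RHS]e {e}.
    apply: eq_big_seq => m mp.
    rewrite comp_mpolyZ -/(toric_map _) toric_mapX !mcoeffZ !mcoeffX.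
    congr (_ * _%:R); apply: congr1; apply/eqP/eqP => [<-|->] //.
    by rewrite tdeg_rep.
  rewrite big1_seq // => m /= mp; rewrite mcoeffZ mcoeffX.
  case: eqP => [e|]; rewrite ?mulr0 //.
  by move: repl; rewrite -e tdeg_rep // eqxx.
have -> : p = \sum_(m <- msupp p) p@_m *: ('X_[m] - 'X_[rep (tdeg m)]).
  under eq_bigr do rewrite scalerBr.
  by rewrite sumrB Esum subr0 -mpolyE.
rewrite big_seq; elim/big_rec: _ => [//|m q mp Pq]; apply: Plin => //.
by apply: Pbin; rewrite tdeg_rep.
Qed.

(** The same exponent, read on the variables of S: [S a] is the edge of H
    matched with the variable a. *)
Definition deg n (G : sgraph n) (T : finType) (S : Svar G -> {set T})
    (u : Svar G -> nat) (x : T) : nat :=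
  (\sum_a (x \in S a) * u a)%N.

Lemma rename_mon (K : fieldType) n (G : sgraph n) r (H : sgraph r)
    (sigma : 'I_#|edges H| -> Svar G) (tau : Svar G -> 'I_#|edges H|) m :
  cancel sigma tau -> cancel tau sigma ->
  rename sigma 'X_[m] = mon K (fun a => m (tau a)).
Proof.
move=> sK tK; rewrite /rename comp_mpolyX [RHS](reindex sigma) /=.
  by apply: eq_bigr => h _; rewrite tnth_mktuple sK.
by exists tau => ? _.
Qed.

Lemma tdegE n (G : sgraph n) r (H : sgraph r)
    (sigma : 'I_#|edges H| -> Svar G) (tau : Svar G -> 'I_#|edges H|) m x :
  cancel sigma tau -> cancel tau sigma ->
  tdeg m x = deg (fun a => enum_val (tau a)) (fun a => m (tau a)) x.
Proof.
move=> sK tK; rewrite mnmE /deg [RHS](reindex sigma) /=.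
  by apply: eq_bigr => h _; rewrite sK.
by exists tau => ? _.
Qed.

Lemma deg_eq_PG (K : fieldType) n (G : sgraph n) r (H : sgraph r)
    (sigma : 'I_#|edges H| -> Svar G) (tau : Svar G -> 'I_#|edges H|) u v :
  cancel sigma tau -> cancel tau sigma ->
  (forall p : {mpoly K[#|edges H|]}, toric_ideal p -> PG (rename sigma p)) ->
  deg (fun a => enum_val (tau a)) u =1 deg (fun a => enum_val (tau a)) v ->
  PG (mon K u - mon K v).
Proof.
move=> sK tK PH eq_deg.
pose mn (t : Svar G -> nat) := [multinom t (sigma h) | h < #|edges H|].
have monE t : mon K t = rename sigma 'X_[mn t].
  rewrite (rename_mon _ _ sK tK); apply: eq_bigr => a _.
  by rewrite mnmE tK.
rewrite !monE /rename -comp_mpolyB; apply: PH.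
rewrite /toric_ideal /toric_map comp_mpolyB -!/(toric_map _) !toric_mapX.
apply/eqP; rewrite subr_eq0; apply/eqP; congr 'X_[_]; apply/mnmP => x.
rewrite !(tdegE _ _ sK tK).
have dE t : deg (fun a => enum_val (tau a)) (fun a => mn t (tau a)) x =
    deg (fun a => enum_val (tau a)) t x.
  by apply: eq_bigr => a _; rewrite mnmE tK.
by rewrite !dE.
Qed.

Lemma comp_mpoly_comp (R : comNzRingType) k l m (s : k.-tuple {mpoly R[l]})
    (t : l.-tuple {mpoly R[m]}) p :
  (p \mPo s) \mPo t = p \mPo [tuple tnth s i \mPo t | i < k].
Proof.
rewrite [p \mPo s]comp_mpolyEX (linear_sum (comp_mpoly t)) [RHS]comp_mpolyEX.
apply: eq_bigr => e _; rewrite linearZ /=; congr (_ *: _).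
rewrite !comp_mpolyX rmorph_prod; apply: eq_bigr => i _.
by rewrite rmorphXn tnth_mktuple.
Qed.

(** * P_G toric implies at most n edges *)

(** A rational relation exists by the rank inequality; the product of all
    denominators makes it integral. *)
Lemma exists_int_relation p q (M : 'M[int]_(p, q)) : (q < p)%N ->
  exists2 z : 'I_p -> int,
    exists i, z i != 0 & forall j, \sum_i z i * M i j = 0.
Proof.
move=> ltqp; pose A := map_mx intr M : 'M[rat]_(p, q).
have : kermx A != 0.
  by rewrite -mxrank_eq0 mxrank_ker subn_eq0 -ltnNge (leq_ltn_trans
    (rank_leq_col A)).
case/rowV0Pn=> c /sub_kermxP cA0 /eqP c_neq0.
pose z j := numq (c 0 j) * \prod_(k | k != j) denq (c 0 k).
have zE j : (z j)%:~R = c 0 j * (\prod_k denq (c 0 k))%:~R.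
  rewrite [in RHS](bigD1 j) //= /z !intrM mulrA; congr (_ * _).
  by rewrite -{2}[c 0 j]divq_num_den mulfVK // intr_eq0 denq_neq0.
exists z.
  apply/existsP; rewrite -[X in is_true X]negbK negb_exists;
    apply/negP => /forallP z0.
  apply: c_neq0; apply/rowP => j; rewrite mxE.
  have := zE j; rewrite (eqP (negbNE (z0 j))) => /esym/eqP.
  rewrite mulf_eq0 intr_eq0 => /orP[/eqP //|].
  by rewrite prodf_seq_eq0 => /hasP[k _]; rewrite denq_eq0.
move=> j; apply: (@intr_inj rat); rewrite rmorph_sum /=.
transitivity ((\prod_k denq (c 0 k))%:~R * (c *m A) 0 j);
  last by rewrite cA0 mxE mulr0.
rewrite mxE mulr_sumr; apply: eq_bigr => i _.
by rewrite intrM zE !mxE mulrAC mulrC.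
Qed.

(** The vertices of the edges of H matched with the x_ii form a set V of at
    most 2n elements, which contains all edges of H. If m > n, then
    m + n > #|V|, so the edges matched with the x_ij, i <= j, satisfy an
    integer relation c. Its positive and negative parts u and v give a binomial
    of I_H = P_G, and the weights that are arbitrary on these variables force
    c = 0. *)
Lemma PG_toric_few_edges (K : fieldType) n (G : sgraph n) r (H : sgraph r) :
  PG_eq_IH K G H -> (#|edges G| <= n)%N.
Proof.
case=> _ [sigma [tau sK tK] PH].
pose S a := enum_val (tau a) : {set 'I_r}.
have SE a : S a \subset S (src a) :|: S (dst a).
  apply/subsetP => x xa; rewrite inE; apply: contraLR isT => /norP[xs xd].
  have /PH : PG (rename sigma ('X_(tau (src a)) * 'X_(tau (dst a)) -
                   'X_(tau a) * 'X_(tau (swap a)) : {mpoly K[_]})).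
    rewrite /rename rmorphB !rmorphM /= !comp_mpolyXU -!tnth_nth !tnth_mktuple
      !tK.
    exact: PG_gen.
  rewrite /toric_ideal /toric_map rmorphB !rmorphM /= !comp_mpolyXU -!tnth_nth
    !tnth_mktuple -/(S _).
  (* Setting the variable of x to 0 and all others to 1 turns the equality of
     the two products into 1 = 0. *)
  move/(congr1 (meval (fun y => (y != x)%:R))).
  rewrite rmorphB !rmorphM !rmorph_prod /= raddf0.
  have ev b : x \notin S b -> \prod_(y in S b) ('X_y).@[fun y =>
    (y != x)%:R] = 1 :> K.
    move=> xb; rewrite big1 // => y yb; rewrite mevalXU.
    by case: eqP => // yx; rewrite -yx yb in xb.
  rewrite (ev (src a)) // (ev (dst a)) // (bigD1 x) //= mevalXU eqxx !mul0r
    mulr1 subr0 => /eqP.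
  by rewrite oner_eq0.
pose V := \bigcup_i S (diag G i).
have cardV : (#|V| <= n.*2)%N.
  have cS a : #|S a| = 2.
    have /imsetP[[x y]] := enum_valP (tau a); rewrite inE /= => Hxy Sa.
    rewrite /S Sa cards2; case: eqP => // xy; by rewrite xy adj_irr in Hxy.
  rewrite -muln2 -[in X in (_ <= X)%N](card_ord n) -sum_nat_const /V.
  elim/big_rec2: _ => [|i k W _ le]; first by rewrite cards0.
  by rewrite (leq_trans (leq_card_setU _ _)) // cS leq_add2l.
have notV a x : x \notin V -> (x \in S a) = false.
  apply: contraNF => /(subsetP (SE a)); rewrite inE => /orP[] xa; apply/bigcupP.
    by exists (val a).1.
  by exists (val a).2.
rewrite leqNgt; apply/negP => lt_nm.
pose B := [set a : Svar G | (val a).1 <= (val a).2]%N.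
have ltVB : (#|V| < #|B|)%N.
  by rewrite card_Svar_base (leq_ltn_trans cardV) // -addnn ltn_add2r.
pose M := \matrix_(i < #|B|, j < #|V|) ((enum_val j \in S (enum_val i))%:R :
  int).
have [z [i0 z_neq0] zM] := exists_int_relation M ltVB.
have i0B := enum_valP i0; set a0 := enum_val i0 in i0B.
pose c a := if a \in B then z (enum_rank_in i0B a) else 0.
have cB i : c (enum_val i) = z i by rewrite /c enum_valP enum_valK_in.
have c0 a : a \notin B -> c a = 0 by rewrite /c => /negPf ->.
pose u a := if 0 <= c a then `|c a|%N else 0%N.
pose v a := if 0 <= c a then 0%N else `|c a|%N.
have uv a : (u a)%:Z - (v a)%:Z = c a.
  rewrite /u /v; case: ifP => [/gez0_abs -> |/negbT]; first by rewrite subr0.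
  by rewrite -ltNge => /ltz0_abs ->; rewrite sub0r opprK.
have sum_uv (f : Svar G -> nat) :
    (\sum_a f a * u a)%N%:Z - (\sum_a f a * v a)%N%:Z =
      \sum_(a in B) (f a)%:Z * c a.
  rewrite !(big_morph Posz PoszD (id1 := 0)) // -sumrB [RHS]big_mkcond /=.
  apply: eq_bigr => a _; rewrite !PoszM -mulrBr uv.
  by case: ifPn => // /c0 ->; rewrite mulr0.
have Puv : PG (mon K u - mon K v).
  apply: (deg_eq_PG sK tK) => [p|x]; first exact: (PH p).2.
  apply/eqP; rewrite -eqz_nat -subr_eq0 sum_uv -/S; apply/eqP.
  have [xV|/notV xV] := boolP (x \in V); last by rewrite big1 // => a _;
    rewrite xV mul0r.
  rewrite big_enum_val /= -[RHS](zM (enum_rank_in xV x)); apply: eq_bigr => i _.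
  by rewrite mxE cB enum_rankK_in // mulrC natz.
have weight (w : Svar G -> nat) :
    (forall a, w (src a) + w (dst a) = w a + w (swap a))%N ->
    \sum_(a in B) (w a)%:Z * c a = 0.
  by move=> wE; apply/eqP; rewrite -sum_uv subr_eq0 (PG_weight wE Puv).
have sum_c : \sum_(a in B) c a = 0.
  by have := weight (fun=> 1%N) (fun=> erefl); under eq_bigr do rewrite mul1r.
(* A weight equal to 3 at a0 and to 2 elsewhere on B, extended below the
   diagonal by w_ji = w_ii + w_jj - w_ij. The prescribed values lie in {2, 3},
   so this subtraction is not truncated. *)
pose w a := if a \in B then (2 + (a == a0))%N else
  (2 + (src a == a0) + (2 + (dst a == a0)) - (2 + (swap a == a0)))%N.
have /weight : forall a, (w (src a) + w (dst a) = w a + w (swap a))%N.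
  have base b : (2 + (b == a0) <= 3)%N by case: eqP.
  have le a : (2 + (swap a == a0) <= 2 + (src a == a0) + (2 + (dst a == a0)))%N.
    by rewrite (leq_trans (base _)) // addnA (leq_trans _ (leq_addr _ _)) //
      addnAC leq_addr.
  move=> a; rewrite /w !inE !leqnn /= leqNgt -leqNgt swapK src_swap dst_swap.
  case: (ltngtP (val a).1 (val a).2) => [la|la|/val_inj ea].
  - rewrite addnC [RHS]addnC subnK //.
    by have := le (swap a); rewrite swapK.
  - by rewrite subnK.
  - have -> : swap a = a.
      by apply: val_inj; rewrite /= -ea {2}ea -surjective_pairing.
    by rewrite /src /dst -ea -(Svar_diag ea).
rewrite (eq_bigr (fun a => c a * 2 + (a == a0)%:R * c a)); last first.
  move=> a aB; rewrite /w aB PoszD mulrDl mulrC; congr (_ + _ * _);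
    by case: eqP.
rewrite big_split /= -mulr_suml sum_c mul0r add0r (bigD1 a0) //= eqxx mul1r.
rewrite big1 ?addr0; last by move=> a /andP[_ /negPf ->]; rewrite mul0r.
by rewrite cB => /eqP; rewrite (negPf z_neq0).
Qed.

(** * The graph H of a graph with at most one cycle *)

(** The numerical form of the equality of the images of x_ii x_jj and
    x_ij x_ji under the toric map, that is, of f_ij lying in I_H. *)
Definition balanced n (G : sgraph n) (T : finType) (S : Svar G -> {set T}) :=
  forall a x, ((x \in S (src a)) + (x \in S (dst a)) =
               (x \in S a) + (x \in S (swap a)))%N.

Definition link n (G : sgraph n) (a : Svar G) := [set (val a).1; (val a).2].

(** The first end of the edge of H matched with x_ij is (i, false) and the
    second one (j, true), unless {i, j} belongs to the set T of straight edges.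
    In that case both booleans are equal to (j < i), which distinguishes x_ij
    from x_ji. *)
Definition end1 n (G : sgraph n) (T : {set {set 'I_n}}) (a : Svar G) :=
  ((val a).1, (link a \in T) && ((val a).2 < (val a).1)%N).

Definition end2 n (G : sgraph n) (T : {set {set 'I_n}}) (a : Svar G) :=
  ((val a).2, (link a \in T) ==> ((val a).2 < (val a).1)%N).

Definition ends n (G : sgraph n) T (a : Svar G) : {set 'I_n * bool} :=
  [set end1 T a; end2 T a].

Lemma link_swap n (G : sgraph n) (a : Svar G) : link (swap a) = link a.
Proof. by rewrite /link setUC. Qed.

Lemma link_diag n (G : sgraph n) (T : {set {set 'I_n}}) (a : Svar G) :
  T \subset edges G -> (val a).1 = (val a).2 -> (link a \in T) = false.
Proof.
move=> /subsetP sT; rewrite /link => ->; apply/negP => /sT/imsetP[[i j]].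
rewrite inE /= => Gij eq1.
have: i \in [set i; j] by rewrite set21.
have: j \in [set i; j] by rewrite set22.
rewrite -eq1 setUid !inE => /eqP ej /eqP ei.
by rewrite ei ej adj_irr in Gij.
Qed.

Lemma end12_neq n (G : sgraph n) (T : {set {set 'I_n}}) (a : Svar G) :
  T \subset edges G -> end1 T a != end2 T a.
Proof.
move=> sT; apply/eqP => -[e12]; rewrite -/(link a) (link_diag sT e12).
by [].
Qed.

Lemma mem_ends n (G : sgraph n) (T : {set {set 'I_n}}) (a : Svar G) x :
  T \subset edges G ->
  ((x \in ends T a) = (x == end1 T a) + (x == end2 T a) :> nat)%N.
Proof.
move=> sT; rewrite !inE; case: eqP => //= ->.
by rewrite (negPf (end12_neq a sT)).
Qed.

Lemma ends_inj n (G : sgraph n) (T : {set {set 'I_n}}) : T \subset edges G ->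
  injective (@ends n G T).
Proof.
move=> sT a b eq_ab.
have ab : (val a).1 = (val b).1 -> (val a).2 = (val b).2 -> a = b.
  by move=> e1 e2; apply: val_inj;
    rewrite [LHS]surjective_pairing e1 e2 -surjective_pairing.
have n1 := end12_neq a sT.
have: end1 T a \in ends T b by rewrite -eq_ab set21.
have: end2 T a \in ends T b by rewrite -eq_ab set22.
rewrite !inE => /orP[]/eqP e2 /orP[]/eqP e1.
- by rewrite e1 e2 eqxx in n1.
- move: e1 e2 => [i1 b1] [i2 b2].
  move: b1 b2; rewrite -/(link a) -/(link b).
  have -> : link b = link a by rewrite /link i1 i2 setUC.
  case: (link a \in T) => //=; rewrite -i1 -i2.
  case: (ltngtP (val a).1 (val a).2) => // /val_inj e _ _.
  by apply: ab; [exact: etrans e i2 | exact: etrans (esym e) i1].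
- by move: e1 e2 => [i1 _] [i2 _]; apply: ab.
- by rewrite e1 e2 eqxx in n1.
Qed.

Lemma balanced_ends n (G : sgraph n) (T : {set {set 'I_n}}) :
  T \subset edges G ->
  balanced (@ends n G T).
Proof.
move=> sT a [k c]; rewrite !mem_ends // /end1 /end2 /= -!pair_eqE /pair_eq /=.
rewrite -!/(link (diag G _)) -/(link a) -/(link (swap a)).
have dT i : [set i; i] \in T = false by apply: (@link_diag _ G T (diag G i)).
rewrite !dT /= -/(link (swap a)) link_swap.
have := @link_diag _ G T a sT.
case: (link a \in T) => [neq|_] /=; last first.
  by case: c; rewrite /= ?andbT ?andbF ?addn0 ?add0n // addnC.
case: (ltngtP (val a).1 (val a).2) => [la|la|/val_inj/neq //];
  by case: c; rewrite /= ?andbT ?andbF ?addn0 ?add0n // addnC.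
Qed.

(** The difference of the degrees at (k, false) and (k, true) is a signed
    form of Kirchhoff's law at k for d a = c a - c (swap a), where c = u - v.
    Here [eps] is the orientation sign that appears on straight edges only:
    on a twisted edge the contributions at the two ends cancel, on a straight
    edge they are equal. So the sum of all laws is a nonzero multiple of the
    value of d on the straight edge. *)
Lemma ends_separate n (G : sgraph n) (T : {set {set 'I_n}})
    (u v : Svar G -> nat) :
  T \subset edges G -> (#|T| <= 1)%N ->
  (forall C, is_cycle G C -> exists2 e, e \in C & e \in T) ->
  standard u -> standard v -> deg (ends T) u =1 deg (ends T) v -> u =1 v.
Proof.
move=> sT T1 cutT stdu stdv eq_deg.
pose c a : int := (u a)%:Z - (v a)%:Z.
have csum x : \sum_a (x \in ends T a)%:Z * c a = 0.
  have degE w : \sum_a (x \in ends T a)%:Z * (w a)%:Z = (deg (ends T) w x)%:Z.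
    by rewrite /deg (big_morph Posz PoszD (id1 := 0)).
  under eq_bigr do rewrite mulrBr.
  by rewrite sumrB !degE eq_deg subrr.
pose d (a : Svar G) : int := c a - c (swap a).
have dswap a : d (swap a) = - d a by rewrite /d swapK [RHS]opprB.
pose eps (a : Svar G) : int :=
  if (link a \in T) && ((val a).2 < (val a).1)%N then -1 else 1.
have flow k : \sum_(a : Svar G | k == (val a).1) eps a * d a = 0.
  have := congr2 (fun x y => x - y) (csum (k, false)) (csum (k, true)).
  rewrite subrr -sumrB => e; rewrite -[RHS]e {e}.
  transitivity (\sum_a (eps a * (k == (val a).1)%:Z * c a -
                        eps (swap a) * (k == (val a).2)%:Z * c a)).
    rewrite sumrB [X in _ - X](reindex_inj (can_inj (@swapK n G))) /= -sumrB
      big_mkcond.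
    apply: eq_bigr => a _; rewrite swapK /=; case: eqP => _.
      by rewrite !mulr1 mulrBr.
    by rewrite !mulr0 !mul0r subrr.
  apply: eq_bigr => a _; rewrite -!mulrBl; congr (_ * _).
  rewrite !mem_ends // /end1 /end2 -!pair_eqE /pair_eq /= -/(link a).
  rewrite /eps link_swap /=; have := @link_diag _ G T a sT.
  case: (link a \in T) => [neq|_] /=; last first.
    by rewrite !andbT !andbF addn0 add0n !mul1r.
  case: (ltngtP (val a).1 (val a).2) => [la|la|/val_inj/neq //] /=;
    rewrite !andbT !andbF ?addn0 ?PoszD ?mulN1r ?mul1r;
    by rewrite ?opprK ?subr0 ?sub0r ?opprD.
have eps_d_swap a : link a \in T -> eps (swap a) * d (swap a) = eps a * d a.
  move=> aT; rewrite dswap mulrN -mulNr; congr (_ * _).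
  rewrite /eps link_swap aT /=.
  have [la|la|/val_inj e] := ltngtP (val a).1 (val a).2; rewrite ?opprK //.
  by rewrite (link_diag sT e) in aT.
have dT a : link a \in T -> d a = 0.
  move=> aT.
  (* The sum of Kirchhoff's laws over all vertices. *)
  have tot : \sum_b eps b * d b = 0.
    transitivity (\sum_k \sum_(b : Svar G | k == (val b).1) eps b * d b).
      by rewrite [LHS](partition_big (fun b : Svar G => (val b).1) xpredT) //=;
        apply: eq_bigr => k _; apply: eq_bigl => b; rewrite eq_sym.
    by rewrite big1.
  have nT : \sum_(b : Svar G | link b \notin T) eps b * d b = 0.
    have e : \sum_(b : Svar G | link b \notin T) eps b * d b = \sum_(b :
      Svar G | link b \notin T) d b.
      by apply: eq_bigr => b /negPf bT; rewrite /eps bT mul1r.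
    rewrite e; have : \sum_(b : Svar G | link b \notin T) d b = - \sum_(b :
      Svar G | link b \notin T) d b.
      rewrite [LHS](reindex_inj (can_inj (@swapK n G))) /= -sumrN.
      by apply: eq_big => b; rewrite ?link_swap ?dswap.
    by move/eqP; rewrite -addr_eq0 -mulr2n mulrn_eq0 => /eqP.
  (* Only a and its swap lie over the straight edge, and there the summands
     agree. *)
  have onlya b : link b \in T -> eps b * d b = eps a * d a.
    move=> bT; have eqT : link b = link a.
      by apply: (card_le1_eqP T1).
    have: (val a).1 \in link b by rewrite eqT set21.
    have: (val a).2 \in link b by rewrite eqT set22.
    have neq : (val a).1 <> (val a).2 by move=> e;
      rewrite (link_diag sT e) in aT.
    rewrite !inE => /orP[]/eqP e2 /orP[]/eqP e1.
    - by case: neq; rewrite e1 e2.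
    - rewrite -(eps_d_swap b) //; congr (eps _ * d _);
      by apply: val_inj; rewrite /= -e1 -e2 -surjective_pairing.
    - congr (eps _ * d _);
      by apply: val_inj; rewrite [LHS]surjective_pairing -e1 -e2
        -surjective_pairing.
    - by case: neq; rewrite e1 e2.
  move: tot; rewrite (bigID (fun b => link b \in T)) /= nT addr0.
  rewrite (eq_bigr _ onlya) sumr_const => /eqP; rewrite mulrn_eq0.
  have /card_gt0P/lt0n_neq0/negPf -> : exists b :
    Svar G, b \in [pred b | link b \in T].
    by exists a.
  by rewrite /eps; case: ifP; rewrite /= ?mulN1r ?mul1r ?oppr_eq0 => _ /eqP.
have dsum k : \sum_(a : Svar G | k == (val a).1) d a = 0.
  rewrite -[RHS](flow k); apply: eq_bigr => a _; rewrite /eps.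
  by case: ifP => [/andP[/dT -> _]|_]; rewrite ?mulr0 ?mul1r.
have d_diag a : (val a).1 = (val a).2 -> d a = 0.
  by move/Svar_diag => ->; rewrite /d (_ : swap _ = diag G (val a).1) ?subrr;
    last exact: val_inj.
have d0 a : d a = 0.
  apply/eqP/negPn/negP => da.
  (* By Kirchhoff's law the support of d has no vertex of degree one, so it
     contains a cycle of G, which avoids T because d vanishes there. *)
  pose e x y := [exists b : Svar G, (val b == (x, y)) && (d b != 0)].
  have eP x y : e x y -> exists2 b : Svar G, val b = (x, y) & d b != 0.
    by case/existsP=> b /andP[/eqP bE db]; exists b.
  have eG x y : e x y -> G x y.
    case/eP=> b bE db; have := valP b; rewrite bE /=; case: eqP => // xy.
    by rewrite d_diag ?bE // eqxx in db.
  have [] := @leafless_has_cycle _ e (val a).1 (val a).2.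
  - have sub x y : e x y -> e y x.
      case/eP=> b bE db; apply/existsP; exists (swap b).
      by rewrite dswap oppr_eq0 db /= bE eqxx.
    by move=> x y; apply/idP/idP; apply: sub.
  - by move=> x; case exx: (e x x) => //; have := eG _ _ exx; rewrite adj_irr.
  - by apply/existsP; exists a; rewrite da -surjective_pairing eqxx.
  - move=> x y /eP[b bE db].
    have := dsum x; rewrite (bigD1 b) /=; last by rewrite bE.
    move=> sum0; case: (pickP (fun b' =>
      [&& x == (val b').1, b' != b & d b' != 0])).
      move=> b' /and3P[/eqP xb' b'b db']; exists (val b').2.
        by apply/existsP; exists b'; rewrite db' xb' -surjective_pairing eqxx.
      apply: contra b'b => /eqP yb'; apply/eqP/val_inj.
      by rewrite bE [LHS]surjective_pairing -xb' yb'.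
    move=> none; rewrite big1 ?addr0 in sum0; first by rewrite sum0 eqxx in db.
    move=> b' /andP[xb' b'b]; have := none b'; rewrite xb' b'b /=.
    by move/negbFE/eqP.
  move=> s szs /andP[cyc_s Us].
  have cycG : ucycle G s.
    by apply/andP; split=> //; apply: sub_cycle cyc_s => x y; exact: eG.
  have [_ /imsetP[x xs ->] xT] := cutT _ (ex_intro _ s (And3 szs cycG erefl)).
  have /eP[b bE] := next_cycle cyc_s xs.
  by rewrite dT ?eqxx // /link bE.
have off a : (val a).1 != (val a).2 -> u a = v a.
  move=> neq; have := stdu a neq; have := stdv a neq.
  have /eqP := d0 a; rewrite /d /c.
  case/boolP: (u a == 0%N) => [/eqP ->|u0] /=;
  case/boolP: (v a == 0%N) => [/eqP ->|v0] //= /eqP.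
  - by move=> e /eqP v0'; move: e; rewrite v0'; lia.
  - by move=> e _ /eqP u0'; move: e; rewrite u0'; lia.
  - by move=> e /eqP v0' /eqP u0'; move: e; rewrite v0' u0'; lia.
move=> a; have [eqa|] := eqVneq (val a).1 (val a).2; last exact: off.
rewrite (Svar_diag eqa).
have := csum ((val a).1, false).
rewrite (bigD1 (diag G (val a).1)) //= [X in _ + X]big1 ?addr0; last first.
  move=> b nb; have [eqb|/off] := eqVneq (val b).1 (val b).2; last first.
    by rewrite /c => ->; rewrite subrr mulr0.
  rewrite mem_ends // /end1 /end2 -/(link b) (link_diag sT eqb) /= -!pair_eqE
    /pair_eq /=.
  rewrite andbT andbF addn0; case: eqP => [ab|]; rewrite ?mul0r //.
  by rewrite ab -(Svar_diag eqb) eqxx in nb.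
rewrite mem_ends // /end1 /end2 -/(link _) (@link_diag _ G T (diag G (val
  a).1)) //=.
by rewrite -!pair_eqE /pair_eq /= eqxx /= mul1r /c => /eqP;
  rewrite subr_eq0 => /eqP[].
Qed.

(** * P_G as the toric ideal of H *)

Lemma graph_of_edge_family r (I : finType) (S : I -> {set 'I_r}) :
  (forall a, #|S a| = 2%N) -> injective S ->
  exists (H : sgraph r) (tau : I -> 'I_#|edges H|),
    bijective tau /\ forall a, enum_val (tau a) = S a.
Proof.
move=> S2 S_inj.
pose e (x y : 'I_r) := (x != y) && [exists a, S a == [set x; y]].
have sym_e : ssrbool.symmetric e by move=> x y; rewrite /e eq_sym setUC.
have irr_e : irreflexive e by move=> x; rewrite /e eqxx.
pose H := SGraph sym_e irr_e.
have SH a : S a \in edges H.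
  have /eqP/cards2P[x [y [xy Sa]]] := S2 a.
  apply/imsetP; exists (x, y) => //; rewrite inE /= /e xy.
  by apply/existsP; exists a; rewrite Sa.
exists H, (fun a => enum_rank_in (SH a) (S a)).
have tauE a : enum_val (enum_rank_in (SH a) (S a)) =
  S a by rewrite enum_rankK_in.
split=> //; apply: inj_card_bij => [a b /(congr1 enum_val)|].
  by rewrite !tauE => /S_inj.
rewrite card_ord -(card_imset _ S_inj); apply/subset_leq_card/subsetP => f.
case/imsetP=> -[x y]; rewrite inE /= => /andP[_ /existsP[a /eqP Sa]] ->.
by apply/imsetP; exists a.
Qed.

(** The toric map factors through [rename] as a morphism defined on S, and
    balance says that this morphism kills the generators of P_G. *)
Lemma PG_toric (K : fieldType) n (G : sgraph n) r (H : sgraph r)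
    (sigma : 'I_#|edges H| -> Svar G) (tau : Svar G -> 'I_#|edges H|) :
  cancel sigma tau -> cancel tau sigma ->
  balanced (fun a => enum_val (tau a)) ->
  forall p : {mpoly K[#|edges H|]}, PG (rename sigma p) -> toric_ideal p.
Proof.
move=> sK tK bal p Pp.
pose S a := enum_val (tau a) : {set 'I_r}.
pose psi : Sring K G -> {mpoly K[r]} :=
  comp_mpoly [tuple \prod_(x in S (enum_val i)) 'X_x | i < #|Svar G|].
have psi_var a : psi (var K a) = \prod_(x in S a) 'X_x.
  by rewrite /psi comp_mpolyXU -tnth_nth tnth_mktuple enum_rankK.
have psi_rename q : psi (rename sigma q) = toric_map q.
  rewrite /psi /rename comp_mpoly_comp; congr comp_mpoly;
    apply: eq_from_tnth => h.
  by rewrite !tnth_mktuple -/(psi _) psi_var /S sK.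
rewrite /toric_ideal -psi_rename; apply: PG_rmorph Pp => a.
have prodE b : \prod_(x in S b) 'X_x =
  \prod_x 'X_x ^+ (x \in S b) :> {mpoly K[r]}.
  by rewrite big_mkcond; apply: eq_bigr => x _; case: ifP.
rewrite !rmorphM /= -!/(psi _) !psi_var !prodE -!big_split /=.
by apply: eq_bigr => x _; rewrite -!exprD bal.
Qed.

(** Both monomials of a binomial in I_H are congruent modulo P_G to standard
    ones. Congruence preserves degrees by [PG_weight], since balance says that
    incidence with a fixed vertex is an admissible weight. So the two standard
    monomials coincide. *)
Lemma toric_PG (K : fieldType) n (G : sgraph n) r (H : sgraph r)
    (sigma : 'I_#|edges H| -> Svar G) (tau : Svar G -> 'I_#|edges H|) :
  cancel sigma tau -> cancel tau sigma ->
  balanced (fun a => enum_val (tau a)) ->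
  (forall u v, standard u -> standard v ->
     deg (fun a => enum_val (tau a)) u =1 deg (fun a => enum_val (tau a)) v ->
     u =1 v) ->
  forall p : {mpoly K[#|edges H|]}, toric_ideal p -> PG (rename sigma p).
Proof.
move=> sK tK bal sep; apply: toric_ideal_binomials.
- by rewrite /rename comp_mpoly0; apply: PG0.
- move=> c p q Pp Pq; rewrite /rename comp_mpolyD comp_mpolyZ -mul_mpolyC.
  exact: PG_lin.
move=> m m' eq_m; rewrite /rename comp_mpolyB -!/(rename _ _) !(rename_mon _ _
  sK tK).
set u := fun a => m (tau a); set v := fun a => m' (tau a).
have [u' stdu Pu] := standard_form K u; have [v' stdv Pv] := standard_form K v.
have deg_PG (w t : Svar G -> nat) : PG (mon K w - mon K t) ->
    deg (fun a => enum_val (tau a)) w =1 deg (fun a => enum_val (tau a)) t.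
  by move=> Pwt x; apply: (PG_weight _ Pwt) => a; apply: bal.
have eq_uv : u' =1 v'.
  apply: sep => // x; rewrite -(deg_PG _ _ Pu) -(deg_PG _ _ Pv).
  by rewrite -!(tdegE _ _ sK tK) eq_m.
by apply: PG_trans Pu _; rewrite (eq_mon K eq_uv); apply: PG_sym.
Qed.

Lemma one_cycle_toric (K : fieldType) n (G : sgraph n) :
  at_most_one_cycle G -> exists (r : nat) (H : sgraph r), PG_eq_IH K G H.
Proof.
case/cycle_transversal=> T [T1 sT cutT].
pose S (a : Svar G) : {set 'I_#|{: 'I_n * bool}|} := enum_rank @: ends T a.
have S_inj : injective S by move=> a b /(imset_inj enum_rank_inj)/(ends_inj sT).
have [a|H [tau [[sigma tK sK] tauE]]] := graph_of_edge_family _ S_inj.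
  by rewrite card_imset ?cards2 ?end12_neq //; apply: enum_rank_inj.
have mem_S a x : (enum_rank x \in enum_val (tau a)) = (x \in ends T a).
  by rewrite tauE mem_imset //; apply: enum_rank_inj.
have bal : balanced (fun a => enum_val (tau a)).
  by move=> a x; rewrite -(enum_valK x) !mem_S balanced_ends.
exists #|{: 'I_n * bool}|, H; split.
  by rewrite -card_Svar -[LHS]card_ord; apply: bij_eq_card; exists tau;
    last exact: tK.
exists sigma; first by exists tau.
move=> p; split; first exact: (PG_toric sK tK bal).
apply: (toric_PG sK tK bal) => u v stdu stdv eq_deg.
apply: (ends_separate sT T1 cutT stdu stdv) => x.
have degE w : deg (ends T) w x = deg (fun a =>
  enum_val (tau a)) w (enum_rank x).
  by apply: eq_bigr => a _; rewrite mem_S.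
by rewrite !degE eq_deg.
Qed.

Theorem theorem3p8 (K : fieldType) (n : nat) (G : sgraph n) :
  connected G ->
  (exists (r : nat) (H : sgraph r), PG_eq_IH K G H) <-> at_most_one_cycle G.
Proof.
move=> connG; split=> [[r [H]] /PG_toric_few_edges|];
  first exact: cycle_space_dim.
exact: one_cycle_toric.
Qed.
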